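(* Let $(X,\mathcal A)$ be a $t$-$(v,k,\lambda)$ design with non-repeated blocks, $N\ge1$, and let $a_s\in\{0,1,\dots,\lambda_s^t\}$, $s\in[t-1]$, be integers such that $|\mathcal R|>\lambda_1$. Let $P$, $B$, $\mathcal S$, $C_B(j)$, $Z$, $Z'$ and $s_1<\dots<s_w$ be as defined in the context. Let $j\in\{1,\dots,w\}$ and $a\in\{0,1,\dots,a_{s_j}-1\}$ be such that $$(a+1)\binom{t-1}{s_j}+\sum_{b=1}^{j-1}\alpha_b>Z-Z'\ge a\binom{t-1}{s_j}+\sum_{b=1}^{j-1}\alpha_b,\qquad \alpha_b=a_{s_b}\binom{t-1}{s_b},$$ and let $T\subseteq\mathcal S$ be a set with $|T\cap C_B(i)|\le Z-Z'$ for all $i\in[t]$ and $$|T|=\sum_{b=1}^{j-1}a_{s_b}\binom{t}{s_b+1}+a\binom{t}{s_j+1}+\left\lfloor\frac{t}{s_j+1}\right\rfloor\left(Z-Z'-\sum_{b=1}^{j-1}\alpha_b-a\binom{t-1}{s_j}\right).$$ Let $\overline B$ be obtained from $B$ by removing (replacing by null) all integers in $T$. Then $(P,\overline B)$ gives, through the algorithm described in the context, a $(v,t,N)$ hotplug coded caching scheme with cache memory $M$ and rate $R$ given by $$\frac MN=\frac{\lambda_1}{\sum_{s=1}^{t-1}a_s\binom ts},\qquad R=\frac{\sum_{s=1}^{t-1}a_s\binom{t}{s+1}-|T|}{\sum_{s=1}^{t-1}a_s\binom ts}.$$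
   Context: Notation: $[n]=\{1,\dots,n\}$; $\binom{[t]}{s}$ also denotes the family of $s$-subsets of $[t]$. Design. For positive integers $v,k,\lambda,t$ with $v>k\ge t$, a $t$-$(v,k,\lambda)$ design is a pair $(X,\mathcal A)$ with $|X|=v$ and $\mathcal A$ a collection of $k$-subsets of $X$ (blocks) such that every set of $t$ distinct points is contained in exactly $\lambda$ blocks. Put $\lambda_1=\lambda\binom{v-1}{t-1}/\binom{k-1}{t-1}$ and $\lambda_s^t=\lambda\binom{v-t}{k-s}/\binom{v-t}{k-t}$. Take $X=\{1,\dots,v\}$. Arrays. $P$ has rows indexed by the blocks $A\in\mathcal A$ and columns by points $i\in X$, with $P(A,i)=*$ if $i\in A$ and null otherwise. Let $\mathcal R=\bigcup_{s=1}^{t-1}\{(Y,i): Y\in\binom{[t]}{s},\ i\in[a_s]\}$, so $|\mathcal R|=\sum_{s=1}^{t-1}a_s\binom ts$. $B$ has rows indexed by $\mathcal R$ and columns by $[t]$, with $B((Y,i),j)=*$ if $j\in Y$ and $B((Y,i),j)=(Y\cup\{j\},i)$ if $j\notin Y$; the non-star entries are called integers. $\mathcal S$ is the set of all integers in $B$, $C_B(j)$ is the set of integers in the $j$-th column of $B$. $Z=\lambda_1$, $Z'=\sum_{s=1}^{t-1}a_s\binom{t-1}{s-1}$, $F=|\mathcal A|$, $F'=|\mathcal R|$. Let $\{s\in[t-1]: a_s\ne0\}=\{s_1<\dots<s_w\}$. Hotplug coded caching. In a $(K,K',N)$ hotplug coded caching system ($K'\le K$) a server stores $N$ files $W_1,\dots,W_N$,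 each of size $L$ bits (for a suitable $L$, so that files can be split and MDS-coded as needed), and is connected to $K$ users by an error-free shared link; each user has a cache of size $M$ files ($ML$ bits). In the placement phase the server fills the caches with functions of the files, knowing $K'$ but neither the identity of the $K'$ users who will be active nor the demands. In the delivery phase an arbitrary set $I\subseteq[K]$, $|I|=K'$, of active users reveals arbitrary demands $(d_i)_{i\in I}\in[N]^{I}$; the server broadcasts a message of size $RL$ bits, depending on the files, $I$ and the demands, such that each active user $i$ recovers $W_{d_i}$ from the message and its own cache. $R$ is the rate. The scheme must work for all files, all $I$ and all demands. Algorithm for $(P,\overline B)$ (here $K=v$, $K'=t$). Placement: divide each $W_n$ into $F'$ equal subfiles and encode them with an $[F,F']$ MDS code (any $F'$ coded symbols determine the information) into coded subfiles $C_{n,A}$, $A\in\mathcal A$; user $k$ stores all $C_{n,A}$ with $P(A,k)=*$. Delivery: given active set $I$ with demands $(d_k)_{k\in I}$, choose a set $\zeta$ of $F'$ rows of $P$ such that $[P]_{\zeta\times I}$ (suitably ordered) has its stars in the same positions as $B$, fill its null entries with the corresponding entries of $\overline B$ (removed entries stay null) to get $(\overline p_{A,k})$, and for each integer $x\in\mathcal S\setminus T$ send $\sum_{A\in\zeta,\,k\in I,\ \overline p_{A,k}=x}C_{d_k,A}$. *)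

(* Defs.v *)
From HB Require Import structures.
From mathcomp Require Import all_boot all_order all_algebra.

Set Implicit Arguments.
Unset Strict Implicit.
Unset Printing Implicit Defensive.

Import Order.TTheory GRing.Theory Num.Theory.
Local Open Scope ring_scope.

(* Designs without repeated blocks, on the point set {0, ..., v-1}. *)
Definition is_design (t v k lam : nat) (D : {set {set 'I_v}}) : Prop :=
  [/\ (0 < t)%N, (0 < lam)%N, (t <= k < v)%N,
      forall A, A \in D -> #|A| = k
    & forall Y : {set 'I_v}, #|Y| = t -> #|[set A in D | Y \subset A]| = lam].

(* Rational division: for a design, both quotients are natural numbers. *)
Definition lambda1 (t v k lam : nat) : rat :=
  lam%:R * 'C(v.-1, t.-1)%:R / 'C(k.-1, t.-1)%:R.

Definition lambda_st (t v k lam s : nat) : rat :=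
  lam%:R * 'C(v - t, k - s)%:R / 'C(v - t, k - t)%:R.

Inductive entry (S : Type) := Star | Null | Int of S.
Arguments Star {S}.
Arguments Null {S}.

Definition is_star (S : Type) (e : entry S) : bool :=
  if e is Star then true else false.

Definition int_of (S : Type) (e : entry S) : option S :=
  if e is Int x then Some x else None.

Section Integers.
Variables (row S : finType) (n : nat) (B : row -> 'I_n -> entry S).

Definition col_ints (j : 'I_n) : {set S} :=
  [set x | [exists r, int_of (B r j) == Some x]].

Definition ints : {set S} := [set x | [exists j, x \in col_ints j]].

Definition remove_ints (T : {set S}) (r : row) (j : 'I_n) : entry S :=
  if B r j is Int x then (if x \in T then Null else Int x) else B r j.

End Integers.

(* Bit strings of length n; the addition is the bitwise exclusive or. *)
Notation bits n := 'rV['F_2]_n.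

Definition pack (X : finType) (l : nat) (f : X -> bits l) : bits (#|X| * l) :=
  mxvec (\matrix_(i < #|X|) f (enum_val i)).

Notation active_set K K' := {I : {set 'I_K} | #|I| == K'}.
Notation active_user I := {k | k \in val I}.

(* Files have L bits. The placement sees only the files; the delivery sees the
   files, the active set and the demands of the active users only. *)
Record hotplug_scheme (K K' N L : nat) := HotplugScheme {
  cache_size : 'I_K -> nat;
  msg_size : nat;
  placement : ('I_N -> bits L) -> forall k : 'I_K, bits (cache_size k);
  delivery : ('I_N -> bits L) ->
    forall I : active_set K K', (active_user I -> 'I_N) -> bits msg_size
}.

(* M and R are measured in files, i.e., in units of L bits. *)
Definition is_hotplug (K K' N L : nat) (sch : hotplug_scheme K K' N L)
    (M R : rat) : Prop :=
  [/\ (K' <= K)%N /\ (0 < L)%N,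
      forall k, (cache_size sch k)%:R = M * L%:R,
      (msg_size sch)%:R = R * L%:R
    & forall (I : active_set K K') (d : active_user I -> 'I_N)
             (k : active_user I),
        exists dec : bits (cache_size sch (val k)) -> bits (msg_size sch) ->
                     bits L,
        forall W : 'I_N -> bits L,
          dec (placement sch W (val k)) (delivery sch W d) = W (d k)].

(* An [F, F'] linear MDS code on symbols of l bits, with coordinates indexed by
   a type X of cardinality F. The i-th row of the argument of enc is the i-th
   information symbol. Linearity is over a finite field E, whose elements, or
   tuples of r of them, are written as l bits by means of phi. *)
Definition mds_code (X : finType) (F' l : nat)
    (enc : 'M['F_2]_(F', l) -> X -> bits l) : Prop :=
  [/\ (F' <= #|X|)%N,
      exists (E : finFieldType) (r : nat) (phi : bits l -> 'rV[E]_r)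
             (G : X -> 'I_F' -> E),
        [/\ bijective phi, {morph phi : x y / x + y}
          & forall u A, phi (enc u A) = \sum_i G A i *: phi (row i u)]
    & forall J : {set X}, #|J| = F' ->
        forall u u', (forall A, A \in J -> enc u A = enc u' A) -> u = u'].

Section Algorithm.
Variables (K K' N : nat) (rowP rowB S : finType).
Variables (P : rowP -> 'I_K -> entry S) (B : rowB -> 'I_K' -> entry S).
Variable T : {set S}.

(* A set zeta of rows of P together with an ordering of zeta and of I: the
   row A and the column k of P correspond to the row sel_row A and the column
   sel_col k of B. The values of sel_row outside zeta are irrelevant. *)
Record selection (I : active_set K K') := Selection {
  zeta : {set rowP};
  sel_row : rowP -> rowB;
  sel_col : active_user I -> 'I_K'
}.

Definition valid_selection (I : active_set K K') (z : selection I) : Prop :=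
  [/\ #|zeta z| = #|rowB|, {in zeta z &, injective (sel_row z)},
      injective (sel_col z)
    & forall A k, A \in zeta z ->
        is_star (P A (val k)) = is_star (B (sel_row z A) (sel_col z k))].

Definition filled (I : active_set K K') (z : selection I)
    (A : rowP) (k : active_user I) : entry S :=
  if P A (val k) is Null then remove_ints B T (sel_row z A) (sel_col z k)
  else P A (val k).

Section Scheme.
Variables (l : nat) (enc : 'M['F_2]_(#|rowB|, l) -> rowP -> bits l).
Variable sel : forall I : active_set K K', selection I.

Definition coded (W : 'I_N -> bits (#|rowB| * l)) (n : 'I_N) (A : rowP) :
  bits l := enc (vec_mx (W n)) A.

Definition alg_placement (W : 'I_N -> bits (#|rowB| * l)) (k : 'I_K) :=
  pack (fun p : {p : 'I_N * rowP | is_star (P p.2 k)} =>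
          coded W (val p).1 (val p).2).

Definition alg_delivery (W : 'I_N -> bits (#|rowB| * l))
    (I : active_set K K') (d : active_user I -> 'I_N) :=
  pack (fun x : {x | x \in ints B :\: T} =>
          \sum_(A in zeta (sel I))
            \sum_(k : active_user I
                  | int_of (filled (sel I) A k) == Some (val x))
              coded W (d k) A).

Definition alg_scheme : hotplug_scheme K K' N (#|rowB| * l) :=
  HotplugScheme alg_placement alg_delivery.

End Scheme.

(* The algorithm can be run: a code exists for some symbol length l, and a
   valid selection exists for every I. Whatever code and selections are used,
   it is a hotplug coded caching scheme. *)
Definition gives_hotplug (M R : rat) : Prop :=
  [/\ exists2 l, (0 < l)%N &
        exists enc : 'M['F_2]_(#|rowB|, l) -> rowP -> bits l, mds_code enc,
      forall I : active_set K K', exists z : selection I, valid_selection z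
    & forall l (enc : 'M['F_2]_(#|rowB|, l) -> rowP -> bits l)
             (sel : forall I : active_set K K', selection I),
        (0 < l)%N -> mds_code enc -> (forall I, valid_selection (sel I)) ->
        is_hotplug (alg_scheme enc sel) M R].

End Algorithm.

Definition arrayP (v : nat) (D : {set {set 'I_v}}) (S : Type)
    (A : {A | A \in D}) (i : 'I_v) : entry S :=
  if i \in val A then Star else Null.

(* The pairs (Y, i), with i < a #|Y| where the mathematics has 1 <= i <= a_s,
   live in a common finite type, which also contains the integers
   (Y :|: [set j], i): the second component ranges over 'I_m for m the largest
   a_s. *)
Notation pairT t a := ({set 'I_t} * 'I_(\max_(1 <= s < t) a s))%type.

Definition rowsR (t : nat) (a : nat -> nat) : {set pairT t a} :=
  [set p : pairT t a | (0 < #|p.1| < t)%N && (p.2 < a #|p.1|)%N].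

Definition arrayB (t : nat) (a : nat -> nat) (r : {r | r \in rowsR t a})
    (j : 'I_t) : entry (pairT t a) :=
  if j \in (val r).1 then Star else Int (j |: (val r).1, (val r).2).

Definition Zprime (t : nat) (a : nat -> nat) : nat :=
  (\sum_(1 <= s < t) a s * 'C(t.-1, s.-1))%N.

Definition supp (t : nat) (a : nat -> nat) : seq nat :=
  [seq s <- index_iota 1 t | a s != 0%N].

(* The b-th element s_b of the support, with b starting from 1. *)
Definition supp_nth (t : nat) (a : nat -> nat) (b : nat) : nat :=
  nth 0%N (supp t a) b.-1.

Definition alpha (t : nat) (a : nat -> nat) (b : nat) : nat :=
  (a (supp_nth t a b) * 'C(t.-1, supp_nth t a b))%N.

(* Main.v *)
Require Import Defs.
From HB Require Import structures.
From mathcomp Require Import all_boot all_order all_algebra all_field zify.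

(* For an active set I and Y a subset of I, inclusion-exclusion on the points
   of I outside Y shows that exactly lambda_s^t blocks meet I in Y, s = #|Y|.
   As a_s <= lambda_s^t, one can choose, injectively in (Y, i), a block whose
   trace on I is Y: these blocks form the rows zeta.
   In B, two occurrences of an integer at (r, j) and (r', j') force a star at
   (r', j), so user j cancels from each message every term but the coded
   subfile it lacks. It thus knows lambda_1 coded subfiles of the demanded file
   from its cache, and at least F' - Z' - (Z - Z') = F' - lambda_1 others from
   the messages; the MDS property concludes. Codes exist: evaluate polynomials
   over a field with 2^l > F elements. *)

Set Implicit Arguments.
Unset Strict Implicit.
Unset Printing Implicit Defensive.

Import Order.TTheory GRing.Theory Num.Theory.

(** * Blocks with a prescribed trace *)

(** Both sides count chains of a p-set in an m-set in an n-set. Multiplied by [p! (m-p)! (n-m)!],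
    each becomes [n!]. *)
Lemma bin_mul_sub n m p :
  (p <= m <= n)%N -> ('C(n, m) * 'C(m, p) = 'C(n, p) * 'C(n - p, m - p))%N.
Proof.
case/andP=> le_pm le_mn; have le_pn := leq_trans le_pm le_mn.
apply/eqP; rewrite -(@eqn_pmul2r (p`! * (m - p)`! * (n - m)`!)); last first.
  by rewrite !muln_gt0 !fact_gt0.
apply/eqP; have Em := bin_fact le_pm; have En := bin_fact le_mn.
have Ep := bin_fact le_pn; have := bin_fact (leq_sub2r p le_mn).
rewrite subnBA // subnK // => Emp.
transitivity n`!.
  by rewrite -En -Em; lia.
by rewrite -Ep -Emp; lia.
Qed.

Section Design.

Variables (t v k lam : nat) (D : {set {set 'I_v}}).
Hypothesis hD : is_design t k lam D.
Implicit Types (Y Z A : {set 'I_v}).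

(** Double counting of the pairs (x, A) with A a block containing Y and x in A outside Y. *)
Lemma design_cover_step Y :
  (#|[set A in D | Y \subset A]| * (k - #|Y|) =
   \sum_(x | x \notin Y) #|[set A in D | x |: Y \subset A]|)%N.
Proof.
case: hD => _ _ _ hk _.
transitivity (\sum_(A in D | Y \subset A) \sum_(x in A :\: Y) 1)%N.
  rewrite -sum1_card big_distrl /=; apply: eq_big => [A | A]; rewrite inE //.
  by case/andP=> AD YA; rewrite mul1n sum1_card cardsDS // (hk _ AD).
under [RHS]eq_bigr do rewrite -sum1_card.
rewrite (exchange_big_dep (fun A => (A \in D) && (Y \subset A))) /=; last first.
  by move=> x A _; rewrite !inE subUset => /and3P[-> _ ->].
apply: eq_bigr => A /andP[AD YA].
by apply: eq_bigl => x; rewrite !inE AD subUset sub1set YA andbT.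
Qed.

(** Descending induction on [#|Y|], starting from the design axiom at size t. The double count
    passes from size s+1 to size s, and the absorption identity matches the binomials. The factor
    ['C(v - t, k - t)] keeps the identity in the naturals. *)
Lemma design_cover Y :
  (#|Y| <= t)%N ->
  (#|[set A in D | Y \subset A]| * 'C(v - t, k - t) =
   lam * 'C(v - #|Y|, k - #|Y|))%N.
Proof.
case: (hD) => _ _ /andP[le_tk lt_kv] _ hl.
move=> leYt; have [n def_t] : exists n, t = (#|Y| + n)%N.
  by exists (t - #|Y|)%N; rewrite subnKC.
elim: n Y def_t {leYt} => [|n IHn] Y def_t.
  by rewrite hl; [rewrite def_t addn0 | rewrite def_t addn0].
have kY : (0 < k - #|Y|)%N by lia.
apply/eqP; rewrite -(eqn_pmul2r kY); apply/eqP.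
rewrite mulnAC design_cover_step big_distrl /=.
under eq_bigr => x xY.
  rewrite IHn; last by rewrite cardsU1 xY; lia.
  rewrite cardsU1 xY; over.
rewrite sum_nat_const.
have -> : #|[pred x | x \notin Y]| = (v - #|Y|)%N.
  have := cardC [in Y]; rewrite card_ord => /(congr1 (subn^~ #|Y|));
    rewrite addKn => <-.
  exact: eq_card.
rewrite mulnCA -mulnA; congr (_ * _)%N.
have -> : (v - (true + #|Y|) = (v - #|Y|).-1)%N by lia.
have Ek : ((k - (true + #|Y|)).+1 = k - #|Y|)%N by lia.
by rewrite mul_bin_diag Ek mulnC.
Qed.

(** Induction on [#|Z|]: among the blocks over Y avoiding Z minus z, those avoiding Z are the ones
    left after discarding those through z. Pascal's rule performs the same subtraction on the
    right-hand side. *)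
Lemma design_cover_avoid Y Z :
  [disjoint Y & Z] -> (#|Y| + #|Z| <= t)%N ->
  (#|[set A in D | (Y \subset A) && [disjoint A & Z]]| * 'C(v - t, k - t) =
   lam * 'C(v - #|Y| - #|Z|, k - #|Y|))%N.
Proof.
case: (hD) => _ _ /andP[le_tk lt_kv] _ _.
have [n] := ubnP #|Z|; elim: n Y Z => // n IHn Y Z leZn dYZ leYZt.
have [-> | [z zZ]] := set_0Vmem Z.
  rewrite cards0 subn0 -design_cover; last by lia.
  by congr (#|pred_of_set _| * _)%N; apply/setP=> A;
    rewrite !inE disjoint_sym disjoints_subset sub0set andbT.
have Zz := cardsD1 z Z; rewrite zZ in Zz.
have dYZz : [disjoint Y & Z :\ z] := disjointWr (subsetDl _ _) dYZ.
have zY : z \notin Y by rewrite (disjointFl dYZ zZ).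
have dzYZz : [disjoint z |: Y & Z :\ z].
  by rewrite disjoints_subset subUset sub1set -disjoints_subset dYZz !inE eqxx.
have E1 := IHn (z |: Y) (Z :\ z) ltac:(lia) dzYZz; rewrite cardsU1 zY in E1.
have {}E1 := E1 ltac:(lia);
  have E2 := IHn Y (Z :\ z) ltac:(lia) dYZz ltac:(lia).
have splitZ : (#|[set A in D | (Y \subset A) && [disjoint A & Z :\ z]]| =
    #|[set A in D | (z |: Y \subset A) && [disjoint A & Z :\ z]]| +
    #|[set A in D | (Y \subset A) && [disjoint A & Z]]|)%N.
  rewrite -[LHS](cardsID [set A : {set 'I_v} | z \in A]); congr (_ + _)%N;
    apply: eq_card => A.
    rewrite !inE subUset sub1set.
    by case: (z \in A) (A \in D) => [] [] //=; rewrite ?andbT ?andbF.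
  rewrite !inE -(setD1K zZ) ![[disjoint A & _]]disjoint_sym.
  rewrite [[disjoint z |: _ & A]]disjoints_subset subUset sub1set inE.
  rewrite -disjoints_subset setU1K ?setD11 //.
  by case: (z \in A) (A \in D) => [] [] //=; rewrite ?andbT ?andbF.
have := congr1 (muln^~ 'C(v - t, k - t)) splitZ; rewrite /= mulnDl E1 E2.
have [m Em] : exists m, (k - #|Y| = m.+1)%N by exists (k - #|Y|).-1; lia.
have [p Ep] : exists p, (v - #|Y| - #|Z :\ z| = p.+1)%N.
  by exists (v - #|Y| - #|Z :\ z|).-1; lia.
rewrite Em Ep Zz.
have -> : (v - (true + #|Y|) - #|Z :\ z| = p)%N by lia.
have -> : (k - (true + #|Y|) = m)%N by lia.
have -> : (v - #|Y| - (true + #|Z :\ z|) = p)%N by lia.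
by rewrite binS addnC mulnDr => /addnI->.
Qed.

(** Having trace Y on I means containing Y and avoiding the rest of I; these two sets have t points
    together, so the previous count applies. *)
Lemma design_trace (I Y : {set 'I_v}) :
  #|I| = t -> Y \subset I ->
  (#|[set A in D | A :&: I == Y]|%:R = lambda_st t v k lam #|Y| :> rat)%R.
Proof.
case: (hD) => _ _ /andP[le_tk lt_kv] _ _ cI YI.
have dYIY : [disjoint Y & I :\: Y].
  by rewrite disjoint_sym disjoints_subset subsetDr.
have cIY : #|I :\: Y| = (t - #|Y|)%N by rewrite cardsDS // cI.
have leYt : (#|Y| <= t)%N by rewrite -cI subset_leq_card.
have := design_cover_avoid dYIY; rewrite cIY subnKC // leqnn => /(_ isT).
have -> : (v - #|Y| - (t - #|Y|) = v - t)%N by lia.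
have -> : [set A in D | (Y \subset A) && [disjoint A & I :\: Y]] =
          [set A in D | A :&: I == Y].
  apply/setP=> A; rewrite !inE; congr (_ && _); apply/andP/eqP => [[YA] | <-].
    rewrite disjoint_sym disjoints_subset => /subsetP IYA; apply/setP=> x.
    rewrite inE; apply/andP/idP => [[xA xI] | xY]; last first.
      by split; [apply: (subsetP YA) | apply: (subsetP YI)].
    by apply: contraLR xA => xY; have := IYA x; rewrite !inE xY xI => ->.
  split; first exact: subsetIl.
  rewrite disjoints_subset; apply/subsetP=> x xA.
  by rewrite !inE xA /= negb_and negbK orbN.
move=> E; rewrite /lambda_st -natrM -E natrM mulfK // pnatr_eq0 -lt0n bin_gt0.
by lia.
Qed.

Lemma design_replication (x : 'I_v) :
  (#|[set A in D | x \in A]|%:R = lambda1 t v k lam :> rat)%R.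
Proof.
case: (hD) => t_gt0 _ /andP[le_tk lt_kv] _ _.
have := design_cover (Y := [set x]); rewrite cards1 !subn1 => /(_ t_gt0).
have -> : [set A in D | [set x] \subset A] = [set A in D | x \in A].
  by apply/setP=> A; rewrite !inE sub1set.
move=> E; have Et : 'C(v - t, k - t) != 0%N by rewrite -lt0n bin_gt0; lia.
have Ek : 'C(k.-1, t.-1) != 0%N by rewrite -lt0n bin_gt0; lia.
rewrite /lambda1; apply: (@mulIf rat 'C(k.-1, t.-1)%:R%R);
  first by rewrite pnatr_eq0.
rewrite mulfVK ?pnatr_eq0 // -!natrM; congr _%:R%R.
(* The covering count for one point has denominator ['C(v - t, k - t)]; the chain identity for t-1
   <= k-1 <= v-1 turns it into ['C(k.-1, t.-1)]. *)
apply/eqP; rewrite -(@eqn_pmul2r 'C(v - t, k - t)) ?lt0n // mulnAC E -mulnA.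
rewrite bin_mul_sub; last by lia.
by rewrite -mulnA; apply/eqP; congr (_ * (_ * 'C(_, _)))%N; lia.
Qed.

End Design.

(** * Counting in the array B *)

Section ArrayB.

Variables (t : nat) (a : nat -> nat).
Local Notation m := (\max_(1 <= s < t) a s).
Local Notation B := (@arrayB t a).

Lemma leq_max_a s : (0 < s < t)%N -> (a s <= m)%N.
Proof.
by move=> hs; rewrite (bigD1_seq s) ?mem_index_iota ?iota_uniq //= leq_maxl.
Qed.

Lemma card_ord_lt p n : (n <= p)%N -> #|[set i : 'I_p | (i < n)%N]| = n.
Proof.
move=> le_np; rewrite -[RHS]card_ord -sum1_card -[RHS]sum1_card
  (big_ord_widen p (fun=> 1%N) le_np).
by apply: eq_bigl => i; rewrite inE.
Qed.

(** The rows, the stars of a column and the integers of B are all sets of this shape. The bound on f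
    ensures that the finite index type truncates nothing. *)
Lemma card_graded_pairs (Q : pred {set 'I_t}) (f : {set 'I_t} -> nat) :
  (forall Y, Q Y -> f Y <= m)%N ->
  #|[set p : pairT t a | Q p.1 && (p.2 < f p.1)%N]| = (\sum_(Y | Q Y) f Y)%N.
Proof.
move=> le_fm; rewrite -sum1_card.
transitivity (\sum_(Y | Q Y) \sum_(i < m | (i < f Y)%N) 1)%N.
  by rewrite pair_big_dep; apply: eq_bigl => p; rewrite inE.
by apply: eq_bigr => Y QY;
  rewrite -[RHS](card_ord_lt (le_fm Y QY)) -sum1_card; apply: eq_bigl => i;
    rewrite inE.
Qed.

Lemma sum_by_card (p q : nat) (Q : pred {set 'I_t}) (f : nat -> nat) :
  (\sum_(Y : {set 'I_t} | (p <= #|Y| < q) && Q Y) f #|Y| =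
   \sum_(p <= s < q) f s * #|[set Y : {set 'I_t} | (#|Y| == s) && Q Y]|)%N.
Proof.
under [RHS]eq_bigr => s _.
  rewrite -sum1_card big_distrr /=.
  under eq_bigl do rewrite inE.
  over.
rewrite (exchange_big_dep (fun Y : {set 'I_t} => Q Y)) /=;
  last by move=> s Y _ /andP[].
rewrite big_mkcond [RHS]big_mkcond /=; apply: eq_bigr => Y _.
case: (Q Y); rewrite ?andbF // andbT.
under eq_bigl do rewrite andbT eq_sym.
rewrite -big_filter.
case: ifP => hY; last first.
  rewrite (_ : [seq _ <- _ | _] = [::]) ?big_nil //.
  apply/eqP; rewrite -[_ == _]negbK -has_filter; apply/hasPn => s.
  by rewrite mem_index_iota; apply: contraTN => /eqP->; rewrite hY.
by rewrite filter_pred1_uniq ?iota_uniq ?mem_index_iota // big_seq1 muln1.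
Qed.

Lemma sum_by_card_bin (p q : nat) (f : nat -> nat) :
  (\sum_(Y : {set 'I_t} | p <= #|Y| < q) f #|Y| =
    \sum_(p <= s < q) f s * 'C(t, s))%N.
Proof.
transitivity (\sum_(Y : {set 'I_t} | (p <= #|Y| < q) && xpredT Y) f #|Y|)%N.
  by apply: eq_bigl => Y; rewrite andbT.
rewrite sum_by_card; apply: eq_bigr => s _;
  rewrite -[in RHS](card_ord t) -card_draws.
by congr (_ * _)%N; apply: eq_card => Y; rewrite !inE andbT.
Qed.

(** The s-sets avoiding j are drawn from t-1 points; Pascal's rule gives the others. *)
Lemma card_draws_in (j : 'I_t) s :
  (0 < s)%N -> #|[set Y : {set 'I_t} | (#|Y| == s) && (j \in Y)]| =
    'C(t.-1, s.-1).
Proof.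
case: s => // s _.
have t_gt0 : (0 < t)%N by apply: leq_ltn_trans (ltn_ord j).
have cj : #|[set~ j]| = t.-1 by rewrite cardsC1 card_ord.
have := cards_draws [set~ j] s.+1; rewrite cj => E1.
have := card_draws 'I_t s.+1;
  rewrite card_ord -(cardsID [set Y : {set 'I_t} | j \in Y]).
have -> : [set A : {set 'I_t} | #|A| == s.+1] :\:
          [set Y : {set 'I_t} | j \in Y] =
          [set A : {set 'I_t} | A \subset [set~ j] & #|A| == s.+1].
  by apply/setP=> A; rewrite !inE -disjoints_subset disjoint_sym disjoints1.
have -> : [set A : {set 'I_t} | #|A| == s.+1] :&:
          [set Y : {set 'I_t} | j \in Y] =
          [set Y : {set 'I_t} | (#|Y| == s.+1) && (j \in Y)].
  by apply/setP=> A; rewrite !inE.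
have -> : 'C(t, s.+1) = ('C(t.-1, s.+1) + 'C(t.-1, s))%N.
  by rewrite -[t in LHS](prednK t_gt0) binS.
by rewrite E1 addnC => /addnI.
Qed.

Lemma card_rowsR : #|rowsR t a| = (\sum_(1 <= s < t) a s * 'C(t, s))%N.
Proof.
rewrite [LHS](card_graded_pairs (Q := fun Y => (0 < #|Y| < t)%N)
  (f := fun Y => a #|Y|)); last first.
  by move=> Y; apply: leq_max_a.
exact: sum_by_card_bin.
Qed.

Lemma card_row_stars (j : 'I_t) :
  #|[set r | is_star (B r j)]| = Zprime t a.
Proof.
have -> : #|[set r | is_star (B r j)]| =
    #|[set p : pairT t a |
         ((0 < #|p.1| < t) && (j \in p.1)) && (p.2 < a #|p.1|)]|%N.
  rewrite -(card_imset _ val_inj); apply: eq_card => p; rewrite inE.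
  apply/imsetP/idP => [[r rj ->] | /andP[/andP[hp jp] ap]].
    have := valP r; rewrite !inE => /andP[-> ->]; move: rj.
    by rewrite inE /arrayB; case: ifP.
  have pR : p \in rowsR t a by rewrite inE hp.
  by exists (Sub p pR) => //; rewrite inE /arrayB /= jp.
rewrite (card_graded_pairs
  (Q := fun Y => (0 < #|Y| < t)%N && (j \in Y)) (f := fun Y => a #|Y|)); last first.
  by move=> Y /andP[hY _]; apply: leq_max_a.
rewrite sum_by_card /Zprime; apply: eq_big_nat => s /andP[s_gt0 _].
by rewrite card_draws_in.
Qed.

(** Any point j of [p.1] exhibits p as an integer: it stands in column j, at the row obtained by
    deleting j. Hence the index is bounded by a at one less than the size. *)
Lemma mem_ints (p : pairT t a) :
  (p \in ints B) = (1 < #|p.1| < t.+1)%N && (p.2 < a #|p.1|.-1)%N.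
Proof.
rewrite inE; apply/existsP/andP => [[j] | [/andP[p_gt1 p_le] ap]].
  rewrite inE => /existsP[r]; rewrite /arrayB; case: ifP => // jr /eqP[<-] /=.
  have := valP r; rewrite inE => /andP[/andP[r_gt0 r_lt] ar].
  by rewrite cardsU1 jr /= add1n !ltnS r_gt0.
have [j jp] : exists j, j \in p.1 by apply/card_gt0P; apply: ltn_trans p_gt1.
have cp : #|p.1| = #|p.1 :\ j|.+1 by rewrite (cardsD1 j) jp.
exists j; rewrite inE; apply/existsP.
have pR : (p.1 :\ j, p.2) \in rowsR t a by rewrite inE /=;
  move: p_gt1 p_le ap; rewrite cp !ltnS => -> -> /=.
exists (exist (fun p => p \in rowsR t a) _ pR);
  rewrite /arrayB /= setD11 /= setD1K //.
by rewrite -surjective_pairing.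
Qed.

Lemma card_ints : #|ints B| = (\sum_(1 <= s < t) a s * 'C(t, s.+1))%N.
Proof.
have -> : #|ints B| =
  #|[set p : pairT t a | (1 < #|p.1| < t.+1) && (p.2 < a #|p.1|.-1)]|%N.
  by apply: eq_card => p; rewrite mem_ints inE.
rewrite (card_graded_pairs (Q := fun Y => (1 < #|Y| < t.+1)%N)
  (f := fun Y => a #|Y|.-1)); last first.
  by move=> Y hY; apply: leq_max_a; lia.
by rewrite (sum_by_card_bin 2 t.+1 (fun s => a s.-1)) big_add1.
Qed.

Lemma arrayB_col_inj r r' j x : B r j = Int x -> B r' j = Int x -> r = r'.
Proof.
rewrite /arrayB; case: ifP => // jr [<-]; case: ifP => // jr' [Ex Ei].
apply: val_inj; rewrite [val r]surjective_pairing [val r']surjective_pairing Ei.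
by rewrite -(setU1K (negbT jr)) -Ex setU1K // jr'.
Qed.

(** In one column an integer determines its row. In distinct columns, j lies in the common set
    [j' |: (val r').1] and differs from j', so it lies in [(val r').1]. *)
Lemma arrayB_int_sym r j r' j' x :
  B r j = Int x -> B r' j' = Int x -> (r, j) != (r', j') -> is_star (B r' j).
Proof.
move=> rjx rjx'; have [jj' | jj' _] := eqVneq j j'.
  by rewrite jj' in rjx *; rewrite (arrayB_col_inj rjx rjx') eqxx.
move: rjx rjx'; rewrite /arrayB; case: ifP => // jr [<-];
  case: ifP => // jr' [Ex _].
have: j \in j' |: (val r').1 by rewrite Ex setU11.
by rewrite !inE (negPf jj') /= => ->.
Qed.

(** In column j each row carries a star, a removed integer or a kept one. As integers do not repeat
    within a column, the removed ones inject into T and the integers of the column. *)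
Lemma card_col_kept (T : {set pairT t a}) (j : 'I_t) :
  (#|{: {r | r \in rowsR t a}}| <= Zprime t a + #|T :&: col_ints B j| +
     #|[set r | int_of (remove_ints B T r j)]|)%N.
Proof.
rewrite -(card_row_stars j).
pose X := [set r | is_star (B r j)].
pose L := [set r | if int_of (B r j) is Some x then x \in T else false].
pose M := [set r | isSome (int_of (remove_ints B T r j))].
have -> : #|{: {r | r \in rowsR t a}}| = #|X :|: L :|: M|.
  rewrite -cardsT; apply: eq_card => r; rewrite !inE /remove_ints.
  by rewrite /arrayB; case: ifP => //= _; case: ifP.
apply: leq_trans (leq_card_setU _ _) _; rewrite leq_add2r.
apply: leq_trans (leq_card_setU _ _) _; rewrite leq_add2l.
(* The default only makes g total: g is used on [L], where the entry is an integer. *)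
pose g r := odflt (j |: (val r).1, (val r).2) (int_of (B r j)).
have gB r : r \in L -> B r j = Int (g r).
  by rewrite inE /g; case: (B r j).
have g_inj : {in L &, injective g}.
  by move=> r r' /gB rL /gB r'L gE; apply: arrayB_col_inj rL _; rewrite r'L gE.
rewrite -(card_in_imset g_inj);
  apply/subset_leq_card/subsetP=> _ /imsetP[r rL ->].
rewrite !inE; apply/andP; split; first by have := rL; rewrite inE (gB _ rL).
by apply/existsP; exists r; rewrite (gB _ rL) /=.
Qed.

End ArrayB.

(** * MDS codes *)

Local Open Scope ring_scope.

(** The field with 2^l elements is an l-dimensional vector space over its prime field; coordinates
    in a basis give [phi]. *)
Lemma bits_field_iso l :
  (0 < l)%N -> exists (E : finFieldType) (phi : bits l -> E),
    [/\ #|E| = (2 ^ l)%N, bijective phi & {morph phi : x y / x + y}].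
Proof.
move=> l_gt0; have [E charE cardE] := pPrimePowerField (isT : prime 2) l_gt0.
have [f flin [g fK gK]] := pprimeChar_vectAxiom charE.
rewrite cardE pfactorK // in f flin g fK gK.
exists E, g; split=> //; first by exists f.
by move=> x y; apply: (can_inj fK); rewrite gK; have := flin 1 (g x) (g y);
  rewrite !scale1r !gK.
Qed.

(** A Reed-Solomon code: coordinate A is the value at [pt A] of the polynomial whose coefficients
    are the information symbols. *)
Lemma mds_code_exists (X : finType) (F' : nat) :
  (F' <= #|X|)%N ->
  exists2 l, (0 < l)%N & exists enc : 'M['F_2]_(F', l) -> X -> bits l,
    mds_code enc.
Proof.
move=> leF'X; exists #|X|.+1 => //.
have [E [phi [cardE [psi phiK psiK] phiD]]] := bits_field_iso (ltn0Sn #|X|).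
have leXE : (#|X| <= #|E|)%N.
  by rewrite cardE; apply: leq_trans (ltnW (ltn_expl _ (isT : 1 < 2)%N));
    apply: leqnSn.
pose pt (A : X) : E := enum_val (widen_ord leXE (enum_rank A)).
have pt_inj : injective pt.
  move=> A A' /enum_val_inj /(congr1 val) /= /ord_inj; exact: enum_rank_inj.
pose val_at u A := \sum_(i < F') pt A ^+ i * phi (row i u).
exists (fun u A => psi (val_at u A)); split=> //.
  exists E, 1%N, (fun x => (phi x)%:M), (fun A i => pt A ^+ i); split.
  - exists (fun M : 'rV[E]_1 => psi (M 0 0)) => [x | M];
    first by rewrite mxE eqxx phiK.
    by rewrite psiK -mx11_scalar.
  - by move=> x y; rewrite phiD raddfD.
  - move=> u A; rewrite psiK; apply/rowP=> z; rewrite !ord1 mxE mulr1n summxE.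
    by apply: eq_bigr => i _; rewrite !mxE mulr1n.
move=> J cardJ u u' eq_uu'.
(* The difference polynomial has size at most F' and vanishes at the F' distinct points of J, hence
   is zero. *)
pose c : 'rV[E]_F' := \row_i (phi (row i u) - phi (row i u')).
have horner_c x : (rVpoly c).[x] = \sum_(i < F') c 0 i * x ^+ i.
  by rewrite horner_poly; apply: eq_bigr => i _; rewrite valK.
have root_c A : A \in J -> root (rVpoly c) (pt A).
  move=> AJ; have /(can_inj psiK) := eq_uu' A AJ; move/eqP.
  rewrite -subr_eq0 -sumrB /root horner_c => /eqP sum0; apply/eqP;
    rewrite -[RHS]sum0.
  by apply: eq_bigr => i _; rewrite mxE mulrC mulrBr.
have c0 : c = 0.
  apply: (can_inj rVpolyK); rewrite linear0; apply/eqP/negPn/negP => c_neq0.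
  have := max_poly_roots c_neq0 (rs := [seq pt A | A in J]).
  rewrite size_image cardJ map_inj_uniq ?enum_uniq // ltnNge size_poly.
  by move=> H; have := H _ isT => /(_ _)/negP[] //;
    apply/allP=> _ /imageP[A AJ ->]; apply: root_c.
apply/row_matrixP=> i; apply: (can_inj phiK); apply/eqP; rewrite -subr_eq0.
by have /rowP/(_ i) := c0; rewrite !mxE => ->.
Qed.

(** * Decoding *)

Lemma pack_inj (X : finType) l (f g : X -> bits l) : pack f = pack g -> f =1 g.
Proof.
move/(can_inj mxvecK) => fg x; apply/rowP=> z.
by have /matrixP/(_ (enum_rank x) z) := fg; rewrite !mxE enum_rankK.
Qed.

Lemma eq_pack (X : finType) l (f g : X -> bits l) : f =1 g -> pack f = pack g.
Proof. by move=> fg; congr mxvec; apply/matrixP=> i z; rewrite !mxE fg. Qed.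

Section Decoding.

Variables (K K' N : nat) (rowP rowB S : finType).
Variables (P : rowP -> 'I_K -> entry S) (B : rowB -> 'I_K' -> entry S).
Variable T : {set S}.
Hypothesis P_no_int : forall A k, int_of (P A k) = None.
Hypothesis B_int_sym : forall r j r' j' x,
  B r j = Int x -> B r' j' = Int x -> (r, j) != (r', j') -> is_star (B r' j).
Variables (I : active_set K K') (z : selection rowP rowB I).
Hypothesis z_valid : valid_selection P B z.

Local Notation filled := (filled P B T).

Lemma filled_int A (k : active_user I) x :
  int_of (filled z A k) = Some x ->
  [/\ is_star (P A (val k)) = false,
      B (sel_row z A) (sel_col z k) = Int x & x \notin T].
Proof.
rewrite /Defs.filled /remove_ints; have := P_no_int A (val k).
case: (P A (val k)) => //= _; case: (B _ _) => //= y.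
by case: ifP => //= yT [<-]; rewrite yT.
Qed.

(** The star property of B carries over to the filled array, because the selection is injective on
    rows and columns and matches the stars of P with those of B. *)
Lemma filled_int_star A A' (k k' : active_user I) x :
  A \in zeta z -> A' \in zeta z -> (A, k) != (A', k') ->
  int_of (filled z A k) = Some x -> int_of (filled z A' k') = Some x ->
  is_star (P A' (val k)).
Proof.
case: z_valid => _ row_inj col_inj star AZ A'Z neq /filled_int[_ Bx _]
  /filled_int[_ Bx' _].
rewrite star //; apply: B_int_sym Bx Bx' _;
  apply: contraNneq neq => [[r_eq c_eq]].
by rewrite (row_inj _ _ AZ A'Z r_eq) (col_inj _ _ c_eq).
Qed.

Variables (l : nat) (enc : 'M['F_2]_(#|rowB|, l) -> rowP -> bits l).
Hypothesis enc_mds : mds_code enc.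
Variables (sel : forall I : active_set K K', selection rowP rowB I).
Hypothesis sel_z : sel I = z.
Local Notation file := (bits (#|rowB| * l)).

(** Decoding is treated as injectivity: two file families give user k the same cache and messages.
    Every term of message x except that of (A, k) is cached by k, so it cancels from the equality of
    messages. *)
Lemma message_coded (W W' : 'I_N -> file) (d : active_user I -> 'I_N) k A x :
  alg_placement P enc W (val k) = alg_placement P enc W' (val k) ->
  alg_delivery P B T enc sel W d = alg_delivery P B T enc sel W' d ->
  A \in zeta z -> int_of (filled z A k) = Some x ->
  coded enc W (d k) A = coded enc W' (d k) A.
Proof.
move=> /pack_inj eq_cache /pack_inj eq_msg AZ Ax.
have cached n A' : is_star (P A' (val k)) -> coded enc W n A' =
  coded enc W' n A'.
  by move=> A'k; have := eq_cache (exist _ (n, A') A'k).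
have [_ Bx xT] := filled_int Ax.
have xS : x \in ints B :\: T.
  rewrite !inE xT /=; apply/existsP; exists (sel_col z k); rewrite inE.
  by apply/existsP; exists (sel_row z A); rewrite Bx /=.
have := eq_msg (exist _ x xS); rewrite /= !sel_z !pair_big_dep /=.
rewrite (bigD1 (A, k)) /= ?AZ ?Ax ?eqxx //
  [RHS](bigD1 (A, k)) /= ?AZ ?Ax ?eqxx //.
rewrite (_ : \sum_(_ | _) _ =
  \sum_(p | (p.1 \in zeta z) && (int_of (filled z p.1 p.2) == Some x)
             && (p != (A, k))) coded enc W' (d p.2) p.1); first by move/addIr.
apply: eq_bigr => p /andP[/andP[pZ /eqP px] pAk]; apply: cached.
by apply: filled_int_star AZ pZ _ Ax px; rewrite -surjective_pairing eq_sym.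
Qed.

Lemma demanded_file (W W' : 'I_N -> file) (d : active_user I -> 'I_N) k :
  (#|rowB| <= #|[set A | is_star (P A (val k))]| +
    #|[set r | int_of (remove_ints B T r (sel_col z k))]|)%N ->
  alg_placement P enc W (val k) = alg_placement P enc W' (val k) ->
  alg_delivery P B T enc sel W d = alg_delivery P B T enc sel W' d ->
  W (d k) = W' (d k).
Proof.
move=> enough eqC eqD; apply: (can_inj vec_mxK).
case: (enc_mds) => _ _ mds.
pose C := [set A | is_star (P A (val k))].
pose Q := [set r | isSome (int_of (remove_ints B T r (sel_col z k)))].
pose M := [set A in zeta z | sel_row z A \in Q].
case: z_valid => cardZ row_inj _ star.
(* An injection between sets of equal size is onto, so each kept integer of the column is met by
   some row of [zeta z]. *)
have row_onto : sel_row z @: zeta z = setT.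
  by apply/eqP; rewrite eqEcard subsetT cardsT -cardZ (card_in_imset row_inj)
    leqnn.
have cardQM : (#|Q| <= #|M|)%N.
  apply: leq_trans (leq_imset_card (sel_row z) M);
    apply/subset_leq_card/subsetP=> r rQ.
  have /imsetP[A AZ rA] : r \in sel_row z @: zeta z by rewrite row_onto inE.
  by rewrite rA; apply: imset_f; rewrite inE AZ -rA.
(* A cached row of [zeta z] faces a star of B, never an integer; so the cached and the received
   subfiles add up. *)
have disCM : [disjoint C & M].
  rewrite disjoints_subset; apply/subsetP=> A; rewrite !inE => AC.
  apply/negP=> /andP[AZ]; move: AC; rewrite star // /remove_ints.
  by case: (B _ _).
have {enough} enough : (#|rowB| <= #|C :|: M|)%N.
  by rewrite cardsU disjoint_setI0 // cards0 subn0; apply: leq_trans enough _;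
    rewrite leq_add2l.
(* The MDS property speaks of exactly F' coordinates, so the known ones are cut down to that
   number. *)
have [J /eqP cardJ sJ] :
    exists2 J : {set rowP}, #|J| == #|rowB| & J \subset C :|: M.
  have : (0 < #|[set J : {set rowP} | J \subset C :|: M & #|J| == #|rowB|]|)%N.
    by rewrite cards_draws bin_gt0.
  by case/card_gt0P=> J; rewrite inE => /andP[? ?]; exists J.
apply: (mds J cardJ) => A /(subsetP sJ); rewrite in_setU.
have [AC _ | AC /= ] := boolP (A \in C).
  have AC' : is_star (P A (val k)) by move: AC; rewrite inE.
  by have := pack_inj eqC (exist _ (d k, A) AC').
rewrite inE => /andP[AZ]; rewrite inE => AQ.
case Ax : (int_of (filled z A k)) => [x|];
  first exact: message_coded eqC eqD AZ Ax.
move: AC Ax AQ; rewrite inE /Defs.filled; have := P_no_int A (val k).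
by case: (P A (val k)) => //= _ _ ->.
Qed.

End Decoding.

(** If two observations determine g, a decoder may search for any preimage and evaluate g there;
    [v0] serves unattained observations. The search runs over finite functions, whence the
    extensionality hypotheses. *)
Lemma ffun_decoder (aT rT : finType) (U1 U2 : eqType) (V : Type) (v0 : V)
    (f1 : (aT -> rT) -> U1) (f2 : (aT -> rT) -> U2) (g : (aT -> rT) -> V) :
  (forall W W', W =1 W' -> f1 W = f1 W') ->
  (forall W W', W =1 W' -> f2 W = f2 W') ->
  (forall W W', f1 W = f1 W' -> f2 W = f2 W' -> g W = g W') ->
  exists dec, forall W, dec (f1 W) (f2 W) = g W.
Proof.
move=> ext1 ext2 det.
exists (fun x y =>
  if [pick w : {ffun aT -> rT} | (f1 w == x) && (f2 w == y)] is Some w then g w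
    else v0) => W.
case: pickP => [w /andP[/eqP E1 /eqP E2] | /(_ (finfun W))]; first exact: det.
by rewrite (ext1 _ W (ffunE W)) (ext2 _ W (ffunE W)) !eqxx.
Qed.

(** Isolates what the algorithm needs of its arrays: a star count Z in each column of P, the star
    property of B, and at least F' - Z kept integers in each column of B. *)
Lemma hotplug_of_arrays (K K' N : nat) (rowP rowB S : finType)
    (P : rowP -> 'I_K -> entry S) (B : rowB -> 'I_K' -> entry S) (T : {set S})
    (Z : nat) (l : nat) (enc : 'M['F_2]_(#|rowB|, l) -> rowP -> bits l)
    (sel : forall I : active_set K K', selection rowP rowB I) :
  (K' <= K)%N -> (0 < #|rowB|)%N -> (0 < l)%N ->
  (forall A k, int_of (P A k) = None) ->
  (forall r j r' j' x, B r j = Int x -> B r' j' = Int x ->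
     (r, j) != (r', j') -> is_star (B r' j)) ->
  (forall k, #|[set A | is_star (P A k)]| = Z) ->
  (forall j, #|rowB| <= Z + #|[set r | int_of (remove_ints B T r j)]|)%N ->
  mds_code enc -> (forall I, valid_selection P B (sel I)) ->
  is_hotplug (@alg_scheme K K' N rowP rowB S P B T l enc sel)
    (N%:R * (Z%:R / #|rowB|%:R)) (#|ints B :\: T|%:R / #|rowB|%:R).
Proof.
move=> leKK B_gt0 l_gt0 P_no_int B_sym cardZ enough enc_mds sel_valid.
have B_neq0 : #|rowB|%:R != 0 :> rat by rewrite pnatr_eq0 -lt0n.
split=> /=; first by rewrite muln_gt0 B_gt0.
(* A cache holds N Z coded subfiles of l bits, and a file has F' l bits. *)
- move=> k; rewrite !natrM !mulrA mulfVK // -!natrM; congr (_ * _)%:R.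
  rewrite card_sig -(cardZ k) -[in RHS](card_ord N) -[#|'I_N|]cardsT -cardsX.
  by apply: eq_card => p; rewrite !inE.
- by rewrite !natrM mulrA mulfVK // -!natrM card_sig; congr (_ * _)%:R.
move=> I d k; apply: (ffun_decoder (0 : bits (#|rowB| * l))
  (g := fun W => W (d k)) (f1 := fun W => alg_placement P enc W (val k))
  (f2 := fun W => alg_delivery P B T enc sel W d)) =>
    [W W' eqW | W W' eqW | W W'].
- by apply: eq_pack => p; rewrite /coded eqW.
- by apply: eq_pack => x; do 2 apply: eq_bigr => ? _; rewrite /coded eqW.
- apply: (demanded_file P_no_int B_sym (sel_valid I) enc_mds (erefl _)).
  by rewrite cardZ.
Qed.

(** * Existence of selections *)

(** The set [zeta] is the image of [block], and [sel_row] is its inverse, sent to [r0] off the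
    image. *)
Lemma selection_of_embedding (K K' : nat) (rowP rowB S : finType)
    (P : rowP -> 'I_K -> entry S) (B : rowB -> 'I_K' -> entry S)
    (I : active_set K K') (r0 : rowB) (block : rowB -> rowP)
    (col : active_user I -> 'I_K') :
  injective block -> injective col ->
  (forall r k, is_star (P (block r) (val k)) = is_star (B r (col k))) ->
  exists z : selection rowP rowB I, valid_selection P B z.
Proof.
move=> block_inj col_inj star.
pose row_of A := odflt r0 [pick r | block r == A].
have blockK : cancel block row_of.
  move=> r; rewrite /row_of; case: pickP => [r' /eqP/block_inj // | /(_ r)].
  by rewrite eqxx.
exists (Selection (block @: rowB) row_of col); split => //=.
- by rewrite card_imset.
- by move=> _ _ /imsetP[r _ ->] /imsetP[r' _ ->]; rewrite !blockK => ->.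
- by move=> _ k /imsetP[r _ ->]; rewrite blockK star.
Qed.

Lemma design_selection (t v k lam : nat) (D : {set {set 'I_v}}) (a : nat -> nat)
    (I : active_set v t) :
  is_design t k lam D ->
  (forall s, (1 <= s < t)%N -> (a s)%:R <= lambda_st t v k lam s) ->
  (0 < #|rowsR t a|)%N ->
  exists z : selection {A | A \in D} {r | r \in rowsR t a} I,
    valid_selection (@arrayP v D (pairT t a)) (@arrayB t a) z.
Proof.
move=> hD ha R_gt0; have cI : #|val I| = t := eqP (valP I).
(* An enumeration of I by the columns of B; [col] inverts it. *)
pose h (j : 'I_t) : 'I_v := enum_val (cast_ord (esym cI) j).
have h_inj : injective h by move=> j j' /enum_val_inj/cast_ord_inj.
pose col (u : active_user I) : 'I_t :=
  cast_ord cI (enum_rank_in (valP u) (val u)).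
have colK u : h (col u) = val u
  by rewrite /h cast_ordK enum_rankK_in // (valP u).
have col_inj : injective col by move=> u u' E; apply: val_inj; rewrite -!colK E.
pose bl (Y : {set 'I_t}) := [set A : {A | A \in D} | val A :&: val I == h @: Y].
have hI (Y : {set 'I_t}) : h @: Y \subset val I.
  by apply/subsetP=> _ /imsetP[j _ ->]; apply: enum_valP.
have enough (r : {r | r \in rowsR t a}) : ((val r).2 < #|bl (val r).1|)%N.
  have := valP r; rewrite inE => /andP[hr /leq_trans]; apply.
  rewrite -(ler_nat rat); apply: le_trans (ha _ hr) _.
  rewrite -(card_imset _ h_inj) -(design_trace hD cI (hI _)) ler_nat.
  rewrite -(card_imset (bl _) val_inj); apply/subset_leq_card/subsetP=> A.
  rewrite inE => /andP[AD AI]; apply/imsetP;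
    exists (exist (fun A => A \in D) A AD) => //.
  by rewrite inE.
have [r0 r0R] := card_gt0P R_gt0;
  pose r1 : {r | r \in rowsR t a} := exist _ r0 r0R.
have [A0 _] := card_gt0P (leq_ltn_trans (leq0n _) (enough r1)).
(* Row (Y, i) receives the i-th block of trace [h @: Y]; [enough] keeps i within range, so the
   default [A0] is never returned. *)
pose block (r : {r | r \in rowsR t a}) := nth A0 (enum (bl (val r).1))
  (val r).2.
have block_trace r : val (block r) :&: val I = h @: (val r).1.
  have : block r \in bl (val r).1 by rewrite -mem_enum mem_nth -?cardE.
  by rewrite inE => /eqP.
apply: (selection_of_embedding r1 (block := block) (col := col)) => //.
  (* The trace of a block recovers Y, and its position in the duplicate-free enumeration recovers
     i. *)
  move=> r r' E; have EY : (val r).1 = (val r').1.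
    by apply: (imset_inj h_inj); rewrite -!block_trace E.
  apply: val_inj; rewrite [val r]surjective_pairing [val r']surjective_pairing
    EY.
  congr pair; apply: val_inj; apply/eqP.
  have := enough r; have := enough r'; move: E;
    rewrite /block EY cardE => E r'lt rlt.
  by rewrite -(nth_uniq A0 rlt r'lt (enum_uniq _)); apply/eqP.
move=> r u; rewrite /arrayP /arrayB.
have -> : (val u \in val (block r)) = (col u \in (val r).1).
  by rewrite -(mem_imset (val r).1 (col u) h_inj) colK -block_trace inE
    (valP u) andbT.
by case: (_ \in _).
Qed.

(** * The scheme obtained from a design *)

Theorem corollary3 (t v k lam N : nat) (D : {set {set 'I_v}})
    (hD : is_design t k lam D) (hN : (0 < N)%N)
    (a : nat -> nat)
    (ha : forall s, (1 <= s < t)%N -> (a s)%:R <= lambda_st t v k lam s)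
    (hR : lambda1 t v k lam < #|rowsR t a|%:R)
    (j : nat) (hj : (1 <= j <= size (supp t a))%N)
    (c : nat) (hc : (c < a (supp_nth t a j))%N)
    (hlt : lambda1 t v k lam - (Zprime t a)%:R <
           (c.+1 * 'C(t.-1, supp_nth t a j)
            + \sum_(1 <= b < j) alpha t a b)%N%:R)
    (hge : (c * 'C(t.-1, supp_nth t a j)
            + \sum_(1 <= b < j) alpha t a b)%N%:R <=
           lambda1 t v k lam - (Zprime t a)%:R)
    (T : {set pairT t a})
    (hTS : T \subset ints (@arrayB t a))
    (hTC : forall i : 'I_t,
       #|T :&: col_ints (@arrayB t a) i|%:R <=
       lambda1 t v k lam - (Zprime t a)%:R)
    (hT : #|T|%:R =
       (\sum_(1 <= b < j) a (supp_nth t a b) * 'C(t, (supp_nth t a b).+1))%N%:R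
       + (c * 'C(t, (supp_nth t a j).+1))%N%:R
       + (t %/ (supp_nth t a j).+1)%N%:R
         * (lambda1 t v k lam - (Zprime t a)%:R
            - (\sum_(1 <= b < j) alpha t a b)%N%:R
            - (c * 'C(t.-1, supp_nth t a j))%N%:R)) :
  exists M R : rat,
    [/\ M / N%:R
          = lambda1 t v k lam / (\sum_(1 <= s < t) a s * 'C(t, s))%N%:R,
        R = ((\sum_(1 <= s < t) a s * 'C(t, s.+1))%N%:R - #|T|%:R)
            / (\sum_(1 <= s < t) a s * 'C(t, s))%N%:R
      & gives_hotplug N (@arrayP v D (pairT t a)) (@arrayB t a) T M R].
Proof.
have [t_gt0 _ /andP[le_tk lt_kv] _ _] := hD.
have le_tv : (t <= v)%N by lia.
have repl (i : 'I_v) :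
    #|[set A : {A | A \in D} | is_star (arrayP (pairT t a) A i)]|%:R =
    lambda1 t v k lam.
  rewrite -(design_replication hD i) -(card_imset _ val_inj); congr _%:R.
  apply: eq_card => A; rewrite inE; apply/imsetP/andP => [[B] | [AD iA]].
    by rewrite inE /arrayP => + ->; rewrite (valP B); case: ifP.
  by exists (exist (fun A => A \in D) A AD); rewrite // inE /arrayP /= iA.
have v_gt0 : (0 < v)%N by lia.
(* The rational lambda_1 is realised as a natural number, the count of blocks through one fixed
   point; by replication it is the same for all points. *)
pose Z := #|[set A : {A | A \in D} |
  is_star (arrayP (pairT t a) A (Ordinal v_gt0))]|.
have defZ : lambda1 t v k lam = Z%:R by rewrite -(repl (Ordinal v_gt0)).
have cardZ i : #|[set A : {A | A \in D} | is_star (arrayP (pairT t a) A i)]| =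
  Z.
  by apply/eqP; rewrite -(eqr_nat rat) repl defZ.
have R_gt0 : (0 < #|rowsR t a|)%N.
  by rewrite -(ltr_nat rat); apply: le_lt_trans hR; rewrite defZ.
have cardR : #|{: {r | r \in rowsR t a}}| = #|rowsR t a|.
  by rewrite card_sig; apply: eq_card.
have cardS : #|ints (@arrayB t a) :\: T|%:R =
    (\sum_(1 <= s < t) a s * 'C(t, s.+1))%N%:R - #|T|%:R :> rat.
  by rewrite cardsDS // natrB ?subset_leq_card // card_ints.
have selP I := design_selection I hD ha R_gt0.
exists (N%:R * (Z%:R / #|{: {r | r \in rowsR t a}}|%:R)),
  (#|ints (@arrayB t a) :\: T|%:R / #|{: {r | r \in rowsR t a}}|%:R); split.
- by rewrite defZ cardR card_rowsR mulrAC divff ?mul1r // pnatr_eq0 -lt0n.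
- by rewrite cardS cardR card_rowsR.
split=> //.
  (* A selection for any one active set contains F' distinct blocks, which yields F' <= F for the
     code. *)
  have [I] : exists I : {set 'I_v}, I \in [set I : {set 'I_v} | #|I| == t].
    by apply/card_gt0P; rewrite card_draws card_ord bin_gt0.
  rewrite inE => cI; have [z [cardz _ _ _]] := selP (exist _ I cI).
  by apply: mds_code_exists; rewrite -cardz max_card.
move=> l enc sel l_gt0 enc_mds sel_valid.
apply: (@hotplug_of_arrays _ _ _ _ _ _ _ _ _ Z) => // [| A i | | i].
- by rewrite cardR.
- by rewrite /arrayP; case: ifP.
- exact: arrayB_int_sym.
(* Stars and removed integers of column i number at most Z' + (Z - Z') = Z. *)
apply: leq_trans (card_col_kept T i) _; rewrite leq_add2r.
by have := hTC i; rewrite defZ lerBrDl -natrD ler_nat.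
Qed.
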